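(* Let $x$ be a nonzero vector in $\mathbb{R}^n$, let $\delta > 0$, and let $x_0\in\mathbb{R}^n$ be an initial estimate to $x$ such that $\|x_0 - x\|_2 \leq \delta\|x\|_2$. Suppose that the measurements $a_1,a_2,\ldots$ are independent random vectors distributed uniformly on the sphere $S^{n-1}$. Let $X_0=x_0$ and let $X_k$ be the estimate given by the randomized Kaczmarz update at step $k$, $$X_{k} = X_{k-1} + \left(\operatorname{sign}(\langle a_k,X_{k-1}\rangle)|\langle a_k,x\rangle| - \langle a_k,X_{k-1}\rangle\right)a_k .$$ Let $B\subset\mathbb{R}^n$ be the set of all points making an angle less than or equal to $\pi/8$ with $x$, and let $\tau := \min\{k\ge 0 : X_k\notin B\}$ (with $\tau=\infty$ if no such $k$ exists). Then for every integer $k \ge 0$, $$\mathbb{E}\left[\|X_k-x\|_2^2\, 1_{\tau = \infty}\right] \leq (1-\alpha_\sigma/n)^k\|x_0-x\|_2^2,$$ where $\alpha_\sigma = 1/2 - 4\sin(\pi/8)/\pi > 0$. Furthermore, $\mathbb{P}(\tau < \infty) \leq (\delta/\sin(\pi/8))^2$.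
   Context: $\operatorname{sign}$ is the usual sign function; angles are defined between nonzero vectors (so $0\notin B$). *)

(* Defs.v *)
From HB Require Import structures.
From mathcomp Require Import all_boot all_order all_algebra.
From mathcomp Require Import all_classical all_reals all_analysis.
Set Implicit Arguments.
Unset Strict Implicit.
Unset Printing Implicit Defensive.
Import Order.TTheory GRing.Theory Num.Theory.
Import numFieldNormedType.Exports.
Local Open Scope classical_set_scope.
Local Open Scope ring_scope.

Section Euclidean.
Context {R : realType} {n : nat}.
Implicit Types u v : 'rV[R]_n.

Definition dot u v : R := \sum_i u 0 i * v 0 i.

(* The library norm on matrices is the sup norm, hence this definition. *)
Definition norm2 u : R := Num.sqrt (dot u u).

(* Only meaningful when u and v are both nonzero. *)
Definition angle u v : R := acos (dot u v / (norm2 u * norm2 v)).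

Definition angular_ball (x : 'rV[R]_n) (theta : R) : set 'rV[R]_n :=
  [set u | u != 0 /\ angle u x <= theta].

Definition unit_sphere : set 'rV[R]_n := [set u | norm2 u = 1].

End Euclidean.

(* R^n with its Borel sigma-algebra; convertible to 'rV[R]_n. *)
Notation borel_rV R n := (g_sigma_algebraType (@open 'rV[R]_n)).

Section Probability.
Context {R : realType}.

(* The uniform distribution on S^{n-1} is the unique Borel probability measure
   on the sphere that is invariant under the orthogonal group. *)
Definition uniform_on_sphere n (mu : probability (borel_rV R n) R) : Prop :=
  mu unit_sphere = 1%E /\
  forall Q : 'M[R]_n, Q *m Q^T = 1%:M ->
  forall A : set (borel_rV R n), measurable A ->
    mu [set u | A ((u : 'rV[R]_n) *m Q)] = mu A.

Definition mutually_independent d (T : measurableType d) (P : probability T R)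
    d' (T' : measurableType d') (X : nat -> {RV P >-> T'}) : Prop :=
  forall (J : seq nat) (A : nat -> set T'), uniq J ->
    (forall j, measurable (A j)) ->
    P (\bigcap_(j in [set` J]) (X j @^-1` A j)) =
    (\prod_(j <- J) P (X j @^-1` A j))%E.

End Probability.

Section Kaczmarz.
Context {R : realType} {n : nat}.

Definition kaczmarz_step (x a y : 'rV[R]_n) : 'rV[R]_n :=
  y + (Num.sg (dot a y) * `|dot a x| - dot a y) *: a.

(* The measurements are indexed from 0: the vector used at step k.+1 is a k. *)
Fixpoint kaczmarz (x x0 : 'rV[R]_n) (a : nat -> 'rV[R]_n) (k : nat) :
    'rV[R]_n :=
  if k is k'.+1 then kaczmarz_step x (a k') (kaczmarz x x0 a k') else x0.

Definition exit_time (B : set 'rV[R]_n) (X : nat -> 'rV[R]_n) : \bar R :=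
  if pselect (exists k, `[< ~ B (X k) >]) is left ex
  then (ex_minn ex)%:R%:E else +oo%E.

End Kaczmarz.

Definition alpha_sigma (R : realType) : R := 2^-1 - 4 * sin (pi / 8) / pi.

(* Main.v *)
Require Import Defs.
From HB Require Import structures.
From mathcomp Require Import all_boot all_order all_algebra.
From mathcomp Require Import all_classical all_reals all_analysis.
From mathcomp Require Import measurable_realfun ring lra.
Import Order.TTheory GRing.Theory Num.Theory.
Import numFieldNormedType.Exports.
Local Open Scope classical_set_scope.
Local Open Scope ring_scope.

(** Write z = y - x for the error of an iterate y, and let a be a unit vector.
    A step moves y orthogonally onto the hyperplane {u | a.u = a.x} when a.x
    and a.y have the same sign, onto {u | a.u = - a.x} when they have opposite
    signs, and leaves y unchanged when a.y = 0.  In all cases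
    ([kaczmarz_step_error]) the new error y' - x satisfies
      |y' - x|^2 + (a.z)^2 <= |z|^2 + 4 (a.x)^2 1[(a.x)(a.y) <= 0].
    For uniform a the mean of (a.z)^2 is |z|^2 / n, so a step contracts on
    average as soon as the mean of the last term is a small multiple of
    |z|^2 / n.

    That mean is estimated using nothing but the invariance of the uniform law
    under reflections.  Let e and f be the directions of x and y, c = e.f, and
    let r be the length of the projection of a on the plane of e and f.
    Exchanging e and f shows that (a.e)^2 restricted to the sign disagreement
    has the same mean as half of (a.e)^2 + (a.f)^2, and there this sum is at
    most (1 - c^2) r^2.  Moreover c >= 23 / 25 for y in the cone, and then sign
    disagreement forces the projection into a narrow double sector around e - f.
    This sector has five mirror images in the plane, any two of which meet only
    at the origin; the mean of r^2 being 2 / n, the part of it carried by one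
    sector is at most 2 / (5 n) ([sector_moment]).  Since
    |z|^2 >= |x|^2 (1 - c^2), the last term above has mean at most
    4 |z|^2 / (5 n), and each step from inside the cone multiplies the mean
    squared error by at most 1 - 1 / (5 n) ([step_contraction]).  This suffices
    because alpha_sigma <= 1 / 5.

    To iterate the estimate, the iteration is frozen when it leaves the cone B:
    Z_k = X_(min (k, tau)) satisfies a recursion Z_(k+1) = g (a_k, Z_k) in
    which the noise a_k is independent of Z_k ([driven_chain_indep]), so a
    bound valid for every fixed state integrates to a bound along the
    recursion ([driven_chain_drift]).  Two consequences finish the proof.  The
    mean of |Z_k - x|^2 on {Z_k in B} decays geometrically and dominates the
    mean of |X_k - x|^2 on {tau = oo}.  The mean of |Z_k - x|^2 does not
    increase, whereas every point outside B is at distance at least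
    sin (pi / 8) |x| from x; Chebyshev's inequality thus bounds
    P (tau <= k) = P (Z_k notin B) independently of k. *)

(** * The Euclidean inner product *)

Section DotProduct.
Context {R : realType} {n : nat}.
Implicit Types (u v w : 'rV[R]_n) (c : R).

Lemma dotC u v : dot u v = dot v u.
Proof. by apply: eq_bigr => i _; rewrite mulrC. Qed.

Lemma dotDl u v w : dot (u + v) w = dot u w + dot v w.
Proof.
by rewrite /dot -big_split; apply: eq_bigr => i _; rewrite mxE mulrDl.
Qed.

Lemma dotZl c u w : dot (c *: u) w = c * dot u w.
Proof. by rewrite /dot mulr_sumr; apply: eq_bigr => i _; rewrite mxE mulrA. Qed.

Lemma dotNl u w : dot (- u) w = - dot u w.
Proof. by rewrite -scaleN1r dotZl mulN1r. Qed.

Lemma dotDr u v w : dot w (u + v) = dot w u + dot w v.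
Proof. by rewrite !(dotC w) dotDl. Qed.

Lemma dotZr c u w : dot w (c *: u) = c * dot w u.
Proof. by rewrite !(dotC w) dotZl. Qed.

Lemma dotNr u w : dot w (- u) = - dot w u.
Proof. by rewrite !(dotC w) dotNl. Qed.

Definition dotE := (dotDl, dotDr, dotNl, dotNr, dotZl, dotZr).

Lemma dot_ge0 u : 0 <= dot u u.
Proof. by apply: sumr_ge0 => i _; rewrite -expr2 sqr_ge0. Qed.

Lemma dot_eq0 u : (dot u u == 0) = (u == 0).
Proof.
apply/idP/eqP => [|->]; last by rewrite -(scale0r 0) dotZl mul0r.
rewrite psumr_eq0 => [/allP u0|i _]; last by rewrite -expr2 sqr_ge0.
apply/rowP => i; rewrite mxE; apply/eqP.
by have := u0 i (mem_index_enum _); rewrite -expr2 sqrf_eq0.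
Qed.

Lemma dot_gt0 u : (0 < dot u u) = (u != 0).
Proof. by rewrite lt0r dot_eq0 dot_ge0 andbT. Qed.

Lemma norm2_sqr u : norm2 u ^+ 2 = dot u u.
Proof. by rewrite sqr_sqrtr// dot_ge0. Qed.

Lemma norm2_ge0 u : 0 <= norm2 u.
Proof. exact: sqrtr_ge0. Qed.

Lemma norm2_gt0 u : (0 < norm2 u) = (u != 0).
Proof. by rewrite sqrtr_gt0 dot_gt0. Qed.

Lemma dot_normalize u : u != 0 ->
  dot ((norm2 u)^-1 *: u) ((norm2 u)^-1 *: u) = 1.
Proof.
by rewrite -norm2_gt0 => u0; rewrite !dotE -norm2_sqr; field; rewrite gt_eqF.
Qed.

Lemma unit_dot_le1 u v : dot u u = 1 -> dot v v = 1 -> dot u v <= 1.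
Proof.
move=> u1 v1; have := dot_ge0 (u - v).
rewrite !dotE u1 v1 (dotC v u); lra.
Qed.

Lemma unit_dot_ge1 u v : dot u u = 1 -> dot v v = 1 -> -1 <= dot u v.
Proof.
move=> u1 v1; have := @unit_dot_le1 (- u) v.
by rewrite !dotE opprK u1 => /(_ erefl v1); rewrite lerNl.
Qed.

End DotProduct.

(** * Borel measurability of vector-valued maps *)

Section BorelRowVectors.
Context {R : realType} {n : nat} {d : measure_display} {T : measurableType d}.

Lemma measurable_entry (i : 'I_n) :
  measurable_fun setT (fun u : borel_rV R n => (u : 'rV[R]_n) 0 i).
Proof.
move=> mD; apply: (measurability _ (RGenOpens.measurableE R)) => //.
move=> _ [_ [a [b ->] <-]]; rewrite setTI; apply: sub_sigma_algebra.
apply: (open_comp (f := fun u : 'rV[R]_n => u 0 i)); last exact: interval_open.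
by move=> u _; exact: coord_continuous.
Qed.

(** Every open set is a countable union of open cubes with rational centres,
    and the preimage of a cube is a finite intersection of coordinatewise
    conditions. *)
Lemma measurable_rV (f : T -> 'rV[R]_n) :
  (forall i, measurable_fun setT (fun t => f t 0 i)) ->
  measurable_fun setT (f : T -> borel_rV R n).
Proof.
move=> mf.
apply: (@measurability _ _ T (borel_rV R n) setT f (@open _) erefl).
move=> _ [A oA <-].
rewrite setTI.
pose q2r (q : 'rV[rat]_n * nat) : 'rV[R]_n := map_mx ratr q.1.
pose box (q : 'rV[rat]_n * nat) : set 'rV[R]_n := ball (q2r q) q.2.+1%:R^-1.
pose boxA q := if `[< box q `<=` A >] then box q else set0.
have AE : A = \bigcup_q boxA q.
  apply/seteqP; split => [u Au|u [q _]]; last first.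
    by rewrite /boxA; case: asboolP => // + uq; exact.
  have : nbhs u A by rewrite openE in oA; exact: oA.
  rewrite -nbhs_ballE => -[e /= e0 eA].
  have [k ke] : exists k : nat, k.+1%:R^-1 < e / 2.
    exists (Num.truncn (e / 2)^-1); rewrite invf_plt ?posrE ?divr_gt0//.
    exact: truncnS_gt.
  have qE (i : 'I_n) : exists q : rat, `|ratr q - u 0 i| < k.+1%:R^-1 :> R.
    have /rat_in_itvoo[q] : u 0 i - k.+1%:R^-1 < u 0 i + k.+1%:R^-1.
      by rewrite ltrD2l gtrN ?invr_gt0.
    by move=> /itvP qi; exists q; rewrite ltr_distl !qi.
  pose q : 'rV[rat]_n := \row_i sval (cid (qE i)).
  have uq : box (q, k) u.
    split; first by rewrite invr_gt0.
    move=> i j; rewrite /ball/= /ball_/= !mxE ord1.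
    by case: cid.
  exists (q, k) => //; rewrite /boxA asboolT// => v vq; apply: eA.
  rewrite (splitr e); apply: (@ball_triangle _ _ (q2r (q, k))).
    by apply: ball_sym; apply: le_ball uq; exact: ltW.
  by apply: le_ball vq; exact: ltW.
have -> : f @^-1` A = \bigcup_q f @^-1` boxA q by rewrite -preimage_bigcup -AE.
apply: countable_bigcupT_measurable => // q.
rewrite /boxA; case: ifP => _; last by rewrite preimage_set0.
have -> : f @^-1` box q =
    \bigcap_(i in [set: 'I_n]) [set t | `|q2r q 0 i - f t 0 i| < q.2.+1%:R^-1].
  apply/seteqP; split=> [t [_ h] i _|t h]; first exact: h.
  by split => [|i j]; rewrite ?invr_gt0// ord1; exact: h.
apply: fin_bigcap_measurable => // i _.
have : measurable_fun setT (fun t => `|q2r q 0 i - f t 0 i| < q.2.+1%:R^-1).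
  apply: measurable_fun_ltr => //; apply: measurableT_comp => //.
  exact: measurable_funB.
by move=> /(_ measurableT [set true] I); rewrite setTI; congr (measurable _);
  apply/seteqP; split => t.
Qed.

Lemma measurable_dot (f g : T -> borel_rV R n) :
  measurable_fun setT f -> measurable_fun setT g ->
  measurable_fun setT (fun t => dot (f t) (g t)).
Proof.
move=> mf mg; apply: measurable_sum => i; apply: measurable_funM.
- exact: measurableT_comp (measurable_entry i) mf.
- exact: measurableT_comp (measurable_entry i) mg.
Qed.

Lemma measurable_sgr (f : T -> R) :
  measurable_fun setT f -> measurable_fun setT (fun t => Num.sg (f t)).
Proof.
move=> mf.
apply: measurable_fun_ifT => //; first exact: measurable_fun_eqr.
by apply: measurable_fun_ifT => //; exact: measurable_fun_ltr.
Qed.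

Lemma measurable_kaczmarz_step (x : 'rV[R]_n) (a y : T -> borel_rV R n) :
  measurable_fun setT a -> measurable_fun setT y ->
  measurable_fun setT (fun t => kaczmarz_step x (a t) (y t) : borel_rV R n).
Proof.
move=> ma my; apply: measurable_rV => i.
under eq_fun do rewrite !mxE.
apply: measurable_funD; first exact: measurableT_comp (measurable_entry i) my.
apply: measurable_funM; last exact: measurableT_comp (measurable_entry i) ma.
apply: measurable_funB; last exact: measurable_dot.
apply: measurable_funM; first by apply: measurable_sgr; exact: measurable_dot.
by apply: measurableT_comp => //; exact: measurable_dot.
Qed.

End BorelRowVectors.

(** * Reflections and the uniform law on the sphere *)

Lemma integral_cst_probability d (T : measurableType d) (R : realType)
    (P : probability T R) (r : \bar R) : (\int[P]_w r = r)%E.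
Proof.
rewrite integral_cst// -[RHS]mule1; congr (_ * _)%E; exact: probability_setT.
Qed.

Section Reflection.
Context {R : realType} {n : nat}.
Implicit Types a h u v : 'rV[R]_n.

Definition reflect_along h a := a - (2 * dot a h / dot h h) *: h.

(** Reflections are self-adjoint, so that reflecting the random vector amounts
    to reflecting the test vectors. *)
Lemma dot_reflect h a u : dot (reflect_along h a) u = dot a (reflect_along h u).
Proof. by rewrite /reflect_along !dotE (dotC h u); ring. Qed.

Lemma reflect_alongK h : h != 0 -> involutive (reflect_along h).
Proof.
move=> h0 a; rewrite /reflect_along !dotE -addrA -opprD -scalerDl.
set s := (X in X *: h); suff -> : s = 0 by rewrite scale0r subr0.
by rewrite /s; field; rewrite dot_eq0.
Qed.

(** Two vectors of the same length are exchanged by the reflection along their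
    difference: reflections act transitively on directions. *)
Lemma reflect_swap u v : u != v -> dot u u = dot v v ->
  reflect_along (u - v) u = v.
Proof.
move=> uv uuvv; rewrite /reflect_along.
have uv0 : dot (u - v) (u - v) != 0 by rewrite dot_eq0 subr_eq0.
suff -> : 2 * dot u (u - v) / dot (u - v) (u - v) = 1.
  by rewrite scale1r opprB addrC subrK.
apply: (mulIf uv0); rewrite divfK// mul1r !dotE (dotC v u) uuvv; ring.
Qed.

Lemma reflect_orthogonal h : h != 0 ->
  exists Q : 'M[R]_n, Q *m Q^T = 1%:M /\ forall a, a *m Q = reflect_along h a.
Proof.
move=> h0; pose Q : 'M[R]_n := 1%:M - (2 / dot h h) *: (h^T *m h).
have QE a : a *m Q = reflect_along h a.
  rewrite mulmxBr mulmx1 -scalemxAr mulmxA; congr (_ - _).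
  have -> : a *m h^T = (dot a h)%:M.
    apply/matrixP => i j; rewrite !mxE !ord1 eqxx mulr1n.
    by apply: eq_bigr => k _; rewrite !mxE.
  by rewrite mul_scalar_mx scalerA mulrAC.
exists Q; split=> //.
have -> : Q^T = Q.
  by rewrite linearB/= linearZ/= trmx1 trmx_mul trmxK.
apply/row_matrixP => i.
rewrite row_mul rowE -[delta_mx 0 i *m Q *m Q]mulmxA mulmxA !QE.
by rewrite reflect_alongK// rowE mulmx1.
Qed.

End Reflection.

Section UniformMoments.
Context {R : realType} {n : nat} (mu : probability (borel_rV R n) R).
Hypothesis mu_unif : uniform_on_sphere mu.
Implicit Types (h u v x y z : 'rV[R]_n).
Local Notation dotm u := (fun a : borel_rV R n => dot (a : 'rV[R]_n) u).

Lemma measurable_dotr u : measurable_fun setT (dotm u).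
Proof. exact: measurable_dot. Qed.
Hint Resolve measurable_dotr : core.

Lemma uniform_ae_unit : {ae mu, forall a, dot (a : 'rV[R]_n) a = 1}.
Proof.
have msphere : measurable [set a : borel_rV R n | dot (a : 'rV[R]_n) a = 1].
  have : measurable_fun setT
      (fun a : borel_rV R n => dot (a : 'rV[R]_n) a == 1).
    by apply: measurable_fun_eqr => //; exact: measurable_dot.
  move=> /(_ measurableT [set true] I); rewrite setTI.
  by congr (measurable _); apply/seteqP; split => a /eqP.
exists (~` [set a : borel_rV R n | dot (a : 'rV[R]_n) a = 1]); split => //.
  exact: measurableC.
rewrite probability_setC//; have [<- _] := mu_unif.
have -> : unit_sphere = [set a : borel_rV R n | dot (a : 'rV[R]_n) a = 1].
  apply/seteqP; split => a /= a1; first by rewrite -norm2_sqr a1 expr1n.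
  by rewrite /unit_sphere/= /norm2 a1 sqrtr1.
by rewrite subee// fin_num_measure.
Qed.

(** The only form in which orthogonal invariance enters the estimates. *)
Lemma integral_reflect h (F : borel_rV R n -> \bar R) : h != 0 ->
  measurable_fun setT F -> (forall a, 0 <= F a)%E ->
  (\int[mu]_a F (reflect_along h a) = \int[mu]_a F a)%E.
Proof.
move=> h0 mF F0; have [Q [QQ QE]] := reflect_orthogonal h h0.
have mr : measurable_fun setT (reflect_along h : borel_rV R n -> borel_rV R n).
  apply: measurable_rV => i; under eq_fun do rewrite !mxE.
  apply: measurable_funB; first exact: measurable_entry.
  by do 3 apply: measurable_funM => //.
rewrite -(@ge0_integral_pushforward _ _ _ _ _ _ mr mu setT F)//.
apply: eq_measure_integral => A mA _.
rewrite /pushforward -[RHS](proj2 mu_unif Q QQ A mA).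
by congr (mu _); apply/seteqP; split => a /=; rewrite QE.
Qed.

(** Move u to v by a reflection. *)
Lemma second_moment_eq u v : dot u u = dot v v ->
  (\int[mu]_a (dot (a : 'rV[R]_n) u ^+ 2)%:E =
   \int[mu]_a (dot (a : 'rV[R]_n) v ^+ 2)%:E)%E.
Proof.
move=> uv; have [->//|unv] := eqVneq u v.
have h0 : u - v != 0 by rewrite subr_eq0.
rewrite -(integral_reflect (u - v) _ h0).
- by apply: eq_integral => a _; rewrite dot_reflect reflect_swap.
- by apply/measurable_EFinP; exact: measurable_funX.
- by move=> a; rewrite lee_fin sqr_ge0.
Qed.

(** The second moment is the same for the n coordinate directions, scaled to
    the length of u, and these n moments add up to the second moment of the
    norm, which is constant on the sphere. *)
Lemma second_moment u : (0 < n)%N ->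
  (\int[mu]_a (dot (a : 'rV[R]_n) u ^+ 2)%:E = (dot u u / n%:R)%:E)%E.
Proof.
move=> n0; set I := (LHS).
suff nI : (n%:R%:E * I = (dot u u)%:E)%E.
  have -> : I = (n%:R^-1%:E * (n%:R%:E * I))%E.
    by rewrite muleA -EFinM mulVf ?mul1e// pnatr_eq0 -lt0n.
  by rewrite nI -EFinM mulrC.
have -> : (n%:R%:E * I = \sum_(i < n) I)%E.
  by rewrite sumr_const card_ord mule_natl.
pose e (i : 'I_n) : 'rV[R]_n := norm2 u *: delta_mx 0 i.
have dote (a : 'rV[R]_n) i : dot a (e i) = norm2 u * a 0 i.
  rewrite dotZr; congr (_ * _); rewrite /dot (bigD1 i)//= mxE !eqxx mulr1.
  by rewrite big1 ?addr0// => j ji; rewrite mxE (negPf ji) andbF mulr0.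
under eq_bigr => i _.
  rewrite /I (second_moment_eq u (e i)); last first.
    by rewrite dote !mxE !eqxx mulr1 -expr2 norm2_sqr.
  over.
rewrite -ge0_integral_sum//; first last.
- by move=> i a _; rewrite lee_fin sqr_ge0.
- by move=> i; apply/measurable_EFinP; exact: measurable_funX.
transitivity (\int[mu]_a (dot u u)%:E)%E; last exact: integral_cst_probability.
apply: ge0_ae_eq_integral => //.
- under eq_fun do rewrite sumEFin; apply/measurable_EFinP.
  by apply: measurable_sum => i; exact: measurable_funX.
- by move=> a _; apply: sume_ge0 => i _; rewrite lee_fin sqr_ge0.
- by move=> a _; rewrite lee_fin dot_ge0.
apply: negligibleS uniform_ae_unit => a /= + a1; apply => _.
rewrite sumEFin; congr EFin.
under eq_bigr do rewrite dote exprMn norm2_sqr.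
by rewrite -mulr_sumr -[RHS]mulr1 -a1.
Qed.

End UniformMoments.

(** * How often two nearby directions see opposite signs *)

Section Sector.
Context {R : realType}.
Implicit Types (u v p q : R).

(** The squared length of (u, v) on the double sector around the second axis,
    of half-angle arccos (sqrt (24 / 25)), about 11.5 degrees. *)
Definition sector_mass u v : R :=
  if 24 / 25 * (u ^+ 2 + v ^+ 2) <= v ^+ 2 then u ^+ 2 + v ^+ 2 else 0.

(** Normal vectors of mirrors through the origin.  They are Pythagorean, so
    that the five images of the second axis, which make angles of 0, +-36.9 and
    +-73.7 degrees with it, have rational coordinates.  Any two of these images
    are more than 32 degrees apart. *)
Definition plane_mirrors : seq (R * R) :=
  [:: (1, 0); (3, 1); (3, -1); (4, 3); (4, -3)].

(** The coordinates of the reflection of (u, v) in the mirror normal to h. *)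
Definition mirror_u (h : R * R) u v : R :=
  u - 2 * (h.1 * u + h.2 * v) / (h.1 ^+ 2 + h.2 ^+ 2) * h.1.
Definition mirror_v (h : R * R) u v : R :=
  v - 2 * (h.1 * u + h.2 * v) / (h.1 ^+ 2 + h.2 ^+ 2) * h.2.

Lemma sector_mass_ge0 u v : 0 <= sector_mass u v.
Proof.
by rewrite /sector_mass; case: ifP => // _; rewrite addr_ge0 ?sqr_ge0.
Qed.

Lemma measurable_sector_mass d (T : measurableType d) (f g : T -> R) :
  measurable_fun setT f -> measurable_fun setT g ->
  measurable_fun setT (fun t => sector_mass (f t) (g t)).
Proof.
move=> mf mg.
have mS : measurable_fun setT (fun t => f t ^+ 2 + g t ^+ 2).
  by apply: measurable_funD; exact: measurable_funX.
apply: measurable_fun_ifT => //.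
by apply: measurable_fun_ler; [exact: measurable_funM|exact: measurable_funX].
Qed.

(** If p and q are the coordinates of a plane vector of length r along two unit
    vectors with inner product c, then p^2 + q^2 - 2 c p q = (1 - c^2) r^2,
    which bounds p^2 + q^2 by (1 + |c|) r^2.  Two sectors around these axes can
    therefore meet only if 48 / 25 <= 1 + |c|. *)
Lemma distinct_axes_excl (d1 d2 e1 e2 u v : R) :
  d1 ^+ 2 + d2 ^+ 2 = 1 -> e1 ^+ 2 + e2 ^+ 2 = 1 ->
  `|d1 * e1 + d2 * e2| < 23 / 25 -> 0 < u ^+ 2 + v ^+ 2 ->
  24 / 25 * (u ^+ 2 + v ^+ 2) <= (d1 * u + d2 * v) ^+ 2 ->
  24 / 25 * (u ^+ 2 + v ^+ 2) <= (e1 * u + e2 * v) ^+ 2 -> False.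
Proof.
move=> dd ee; set c := _ + _ * e2; set r2 := u ^+ 2 + _.
set p := d1 * u + _; set q := e1 * u + _.
rewrite ltr_norml => /andP[c0 c1] r20 hp hq.
have gram : p ^+ 2 + q ^+ 2 - 2 * c * (p * q) = (1 - c ^+ 2) * r2.
  have -> : p ^+ 2 + q ^+ 2 =
      p ^+ 2 * (e1 ^+ 2 + e2 ^+ 2) + q ^+ 2 * (d1 ^+ 2 + d2 ^+ 2).
    by rewrite dd ee !mulr1.
  have -> : 1 - c ^+ 2 = (d1 ^+ 2 + d2 ^+ 2) * (e1 ^+ 2 + e2 ^+ 2) - c ^+ 2.
    by rewrite dd ee mulr1.
  by rewrite /p /q /c /r2; ring.
have [cge0|clt0] := leP 0 c.
  have : (1 - c) * (p ^+ 2 + q ^+ 2) <= (1 - c ^+ 2) * r2.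
    rewrite -gram -subr_ge0 (_ : _ - _ = c * (p - q) ^+ 2); last by ring.
    by rewrite mulr_ge0 ?sqr_ge0.
  have : (1 - c) * (48 / 25 * r2) <= (1 - c) * (p ^+ 2 + q ^+ 2).
    by rewrite ler_pM2l; lra.
  have : 0 < (1 - c) * r2 * (23 / 25 - c) by rewrite !mulr_gt0//; lra.
  lra.
have : (1 + c) * (p ^+ 2 + q ^+ 2) <= (1 - c ^+ 2) * r2.
  rewrite -gram -subr_ge0 (_ : _ - _ = - c * (p + q) ^+ 2); last by ring.
  by rewrite mulr_ge0 ?sqr_ge0// oppr_ge0 ltW.
have : (1 + c) * (48 / 25 * r2) <= (1 + c) * (p ^+ 2 + q ^+ 2).
  by rewrite ler_pM2l; lra.
have : 0 < (1 + c) * r2 * (23 / 25 + c) by rewrite !mulr_gt0//; lra.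
lra.
Qed.

(** At most one of the five terms is nonzero. *)
Lemma sectors_disjoint u v :
  \sum_(h <- plane_mirrors) sector_mass (mirror_u h u v) (mirror_v h u v)
  <= u ^+ 2 + v ^+ 2.
Proof.
set r2 := u ^+ 2 + v ^+ 2.
have massE h d1 d2 : (mirror_u h u v) ^+ 2 + (d1 * u + d2 * v) ^+ 2 = r2 ->
    mirror_v h u v = d1 * u + d2 * v ->
    sector_mass (mirror_u h u v) (mirror_v h u v) =
    if 24 / 25 * r2 <= (d1 * u + d2 * v) ^+ 2 then r2 else 0.
  by rewrite /sector_mass => + -> => ->.
rewrite /plane_mirrors !big_cons big_nil.
(* The numbers are the images of the second axis under the five mirrors. *)
rewrite (massE _ 0 1) 1?(massE _ (- (3 / 5)) (4 / 5))
  1?(massE _ (3 / 5) (4 / 5)) 1?(massE _ (- (24 / 25)) (7 / 25))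
  1?(massE _ (24 / 25) (7 / 25));
  try by rewrite /mirror_u /mirror_v /r2 /=; field.
have : 0 <= r2 by rewrite addr_ge0 ?sqr_ge0.
rewrite le_eqVlt => /orP[/eqP <-|r20]; first by rewrite !if_same; lra.
pose near_axis d1 d2 := 24 / 25 * r2 <= (d1 * u + d2 * v) ^+ 2.
have excl d1 d2 e1 e2 : d1 ^+ 2 + d2 ^+ 2 = 1 -> e1 ^+ 2 + e2 ^+ 2 = 1 ->
    -(23 / 25) < d1 * e1 + d2 * e2 < 23 / 25 ->
    near_axis d1 d2 -> near_axis e1 e2 -> False.
  by move=> dd ee de; apply: distinct_axes_excl; rewrite ?ltr_norml.
rewrite -/(near_axis 0 1) -/(near_axis (- (3 / 5)) (4 / 5)).
rewrite -/(near_axis (3 / 5) (4 / 5)) -/(near_axis (- (24 / 25)) (7 / 25)).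
rewrite -/(near_axis (24 / 25) (7 / 25)).
do 5?[case: ifPn => ?]; rewrite ?(add0r, addr0) ?(ltW r20) ?lexx //; exfalso;
  match goal with
  | d : is_true (near_axis _ _), e : is_true (near_axis _ _) |- _ =>
    by apply: (excl _ _ _ _ _ _ _ d e); clear; lra
  end.
Qed.

(** Here p and q are the coordinates of a vector along unit vectors e and f
    with inner product c, and (u, v) its coordinates along the orthonormal basis
    obtained by normalizing e + f and e - f.  The condition p q <= 0 reads
    (1 + c) u^2 <= (1 - c) v^2: the vector is close to the direction e - f, the
    more so as c is close to 1.  For c = 23 / 25 the ratio
    (1 - c) / (1 + c) = 1 / 24 is that of the boundary of the sector. *)
Lemma opposite_signs_sector p q c u v : 23 / 25 <= c -> c < 1 ->
  (p + q) ^+ 2 = (2 + 2 * c) * u ^+ 2 -> (p - q) ^+ 2 = (2 - 2 * c) * v ^+ 2 ->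
  p * q <= 0 -> p ^+ 2 + q ^+ 2 <= (1 - c ^+ 2) * sector_mass u v.
Proof.
move=> c0 c1 hu hv pq.
have uv : (1 + c) * u ^+ 2 <= (1 - c) * v ^+ 2.
  have : 4 * (p * q) = (2 + 2 * c) * u ^+ 2 - (2 - 2 * c) * v ^+ 2.
    by rewrite -hu -hv; ring.
  lra.
have v0 := sqr_ge0 v; have u0 := sqr_ge0 u.
have u24 : 24 * u ^+ 2 <= v ^+ 2.
  have h1 : (48 / 25) * u ^+ 2 <= (1 + c) * u ^+ 2.
    by apply: ler_wpM2r => //; lra.
  have h2 : (1 - c) * v ^+ 2 <= (2 / 25) * v ^+ 2.
    by apply: ler_wpM2r => //; lra.
  lra.
rewrite /sector_mass ifT; last by lra.
have -> : p ^+ 2 + q ^+ 2 = (1 + c) * u ^+ 2 + (1 - c) * v ^+ 2.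
  have : 2 * (p ^+ 2 + q ^+ 2) = (p + q) ^+ 2 + (p - q) ^+ 2 by ring.
  by rewrite hu hv; lra.
have : 0 <= c * ((1 - c) * v ^+ 2 - (1 + c) * u ^+ 2).
  by rewrite mulr_ge0 ?subr_ge0//; lra.
lra.
Qed.

End Sector.

Section Contraction.
Context {R : realType} {n : nat} (mu : probability (borel_rV R n) R).
Hypothesis mu_unif : uniform_on_sphere mu.
Hypothesis n_gt0 : (0 < n)%N.
Implicit Types (b c e f u v x y z : 'rV[R]_n).
Local Notation dotm u := (fun a : borel_rV R n => dot (a : 'rV[R]_n) u).
Local Hint Resolve measurable_dotr : core.

(** The sector and its mirror images carry the same mass, and together they
    carry no more than the whole plane, whose mass is 2 / n. *)
Lemma sector_moment b c : dot b b = 1 -> dot c c = 1 -> dot b c = 0 ->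
  (\int[mu]_a (sector_mass (dot (a : 'rV[R]_n) b) (dot (a : 'rV[R]_n) c))%:E
   <= (2 / (5 * n%:R))%:E)%E.
Proof.
move=> bb cc bc; set S := (\int[mu]_a _)%E.
pose mirrored (h : R * R) (a : borel_rV R n) : R :=
  sector_mass (mirror_u h (dot (a : 'rV[R]_n) b) (dot (a : 'rV[R]_n) c))
              (mirror_v h (dot (a : 'rV[R]_n) b) (dot (a : 'rV[R]_n) c)).
have mS : measurable_fun setT (fun a : borel_rV R n =>
    (sector_mass (dot (a : 'rV[R]_n) b) (dot (a : 'rV[R]_n) c))%:E).
  by apply/measurable_EFinP; exact: measurable_sector_mass.
have mM h : measurable_fun setT (fun a : borel_rV R n => (mirrored h a)%:E).
  apply/measurable_EFinP; apply: measurable_sector_mass;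
  rewrite /mirror_u /mirror_v;
  apply: measurable_funB => //; apply: measurable_funM => //;
  apply: measurable_funM => //; apply: measurable_funM => //;
  by apply: measurable_funD; exact: measurable_funM.
have mirrorS h : h \in @plane_mirrors R -> (\int[mu]_a (mirrored h a)%:E = S)%E.
  move=> hP.
  have hh : h.1 ^+ 2 + h.2 ^+ 2 != 0.
    by move: hP; rewrite !inE => /orP[|/orP[|/orP[|/orP[]]]] /eqP -> /=; lra.
  pose w : 'rV[R]_n := h.1 *: b + h.2 *: c.
  have ww : dot w w = h.1 ^+ 2 + h.2 ^+ 2.
    by rewrite /w !dotE bb cc (dotC c b) bc; ring.
  have wb : dot w b = h.1 by rewrite /w !dotE bb (dotC c b) bc; ring.
  have wc : dot w c = h.2 by rewrite /w !dotE cc bc; ring.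
  have aw a : dot a w = h.1 * dot a b + h.2 * dot a c by rewrite /w !dotE.
  clearbody w.
  have w0 : w != 0 by rewrite -dot_eq0 ww.
  rewrite -[RHS](integral_reflect _ mu_unif w _ w0 mS); last first.
    by move=> a; rewrite lee_fin sector_mass_ge0.
  apply: eq_integral => a _; congr EFin; rewrite /mirrored.
  by rewrite /reflect_along !dotDl !dotNl !dotZl ww wb wc aw.
have : (\sum_(h <- plane_mirrors) \int[mu]_a (mirrored h a)%:E
    <= (2 / n%:R)%:E)%E.
  rewrite -ge0_integral_sum//; last first.
    by move=> h a _; rewrite lee_fin sector_mass_ge0.
  have -> : (2 / n%:R)%:E =
      (\int[mu]_a ((dot (a : 'rV[R]_n) b ^+ 2)%:E +
                   (dot (a : 'rV[R]_n) c ^+ 2)%:E))%E.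
    rewrite ge0_integralD//; first last.
    - by apply/measurable_EFinP; exact: measurable_funX.
    - by move=> a _; rewrite lee_fin sqr_ge0.
    - by apply/measurable_EFinP; exact: measurable_funX.
    - by move=> a _; rewrite lee_fin sqr_ge0.
    by rewrite !second_moment// bb cc -EFinD -mulrDl.
  apply: ge0_le_integral => //.
  - by move=> a _; apply: sume_ge0 => h _; rewrite lee_fin sector_mass_ge0.
  - under eq_fun do rewrite sumEFin; apply/measurable_EFinP.
    by apply: measurable_sum => h; have /measurable_EFinP := mM h.
  - by apply: emeasurable_funD; apply/measurable_EFinP; exact: measurable_funX.
  - by move=> a _; rewrite sumEFin lee_fin; exact: sectors_disjoint.
rewrite (eq_big_seq _ mirrorS) big_const_seq count_predT /= => S5.
have -> : (2 / (5 * n%:R))%:E = (5^-1%:E * (2 / n%:R)%:E)%E :> \bar R.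
  by rewrite -EFinM invfM mulrCA.
have -> : S = (5^-1%:E * (5%:R%:E * S))%E.
  by rewrite muleA -EFinM mulVf ?mul1e.
rewrite lee_pmul2l ?lte_fin ?invr_gt0 ?ltr0n//.
by move: S5; rewrite adde0 mule_natl.
Qed.

(** The factor 1 / 2 gained by exchanging e and f is essential: without it the
    error term of a step would only be bounded by 8 |z|^2 / (5 n), which
    exceeds the gain |z|^2 / n. *)
Lemma opposite_signs_moment e f : dot e e = 1 -> dot f f = 1 ->
  23 / 25 <= dot e f ->
  (\int[mu]_a (if dot (a : 'rV[R]_n) e * dot (a : 'rV[R]_n) f <= 0
               then dot (a : 'rV[R]_n) e ^+ 2 else 0)%:E
   <= ((1 - dot e f ^+ 2) / (5 * n%:R))%:E)%E.
Proof.
move=> ee ff ef; set c := dot e f in ef *.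
pose opp u v (a : borel_rV R n) : R :=
  if dot (a : 'rV[R]_n) u * dot (a : 'rV[R]_n) v <= 0
  then dot (a : 'rV[R]_n) u ^+ 2 else 0.
have opp0 u v a : 0 <= opp u v a by rewrite /opp; case: ifP; rewrite ?sqr_ge0.
have mopp u v : measurable_fun setT (fun a => (opp u v a)%:E).
  apply/measurable_EFinP; apply: measurable_fun_ifT => //.
    by apply: measurable_fun_ler => //; exact: measurable_funM.
  exact: measurable_funX.
have := unit_dot_le1 _ _ ee ff; rewrite -/c le_eqVlt => /orP[/eqP c1|c1].
  have fe : f = e.
    apply/eqP; rewrite -subr_eq0 -dot_eq0 !dotE ee ff (dotC f e) -/c c1.
    by apply/eqP; lra.
  rewrite c1 expr1n subrr mul0r fe integral0_eq// => a _.
  case: ifPn => // ae0; congr EFin; apply/eqP.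
  by rewrite eq_le sqr_ge0 andbT expr2.
have e_neq_f : e != f.
  by apply/eqP => efE; move: c1; rewrite /c -efE ee ltxx.
have -> : (\int[mu]_a (if dot (a : 'rV[R]_n) e * dot (a : 'rV[R]_n) f <= 0
    then dot (a : 'rV[R]_n) e ^+ 2 else 0)%:E =
  \int[mu]_a (opp e f a)%:E)%E by [].
set S := (\int[mu]_a _)%E.
have S_swap : S = (\int[mu]_a (opp f e a)%:E)%E.
  have ef0 : e - f != 0 by rewrite subr_eq0.
  rewrite -[RHS](integral_reflect _ mu_unif (e - f) _ ef0 (mopp f e));
    last first.
    by move=> a; rewrite lee_fin.
  apply: eq_integral => a _; rewrite /opp !dot_reflect.
  have swap_e := reflect_swap e f e_neq_f (etrans ee (esym ff)).
  have swap_f : reflect_along (e - f) f = e.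
    by rewrite -[RHS](reflect_alongK _ ef0) swap_e.
  by rewrite swap_e swap_f.
pose b := (norm2 (e + f))^-1 *: (e + f).
pose g := (norm2 (e - f))^-1 *: (e - f).
have dsum : dot (e + f) (e + f) = 2 + 2 * c.
  by rewrite !dotE ee ff (dotC f e) -/c; ring.
have ddif : dot (e - f) (e - f) = 2 - 2 * c.
  by rewrite !dotE ee ff (dotC f e) -/c; ring.
have s0 : e + f != 0 by rewrite -dot_eq0 dsum; apply/eqP; lra.
have d0 : e - f != 0 by rewrite subr_eq0.
have bg : dot b g = 0.
  by rewrite /b /g dotZl dotZr !dotE ee ff (dotC f e); ring.
have S2 : (S + S <= ((1 - c ^+ 2) * (2 / (5 * n%:R)))%:E)%E.
  rewrite [in X in (X + _)%E]/S [in X in (_ + X)%E]S_swap -ge0_integralD//;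
    try by move=> a _; rewrite lee_fin opp0.
  apply: (@le_trans _ _ (\int[mu]_a ((1 - c ^+ 2)%:E *
      (sector_mass (dot (a : 'rV[R]_n) b) (dot (a : 'rV[R]_n) g))%:E))%E).
    apply: ge0_le_integral => //.
    - by move=> a _; apply: adde_ge0; rewrite lee_fin opp0.
    - exact: emeasurable_funD.
    - apply: emeasurable_funM => //; apply/measurable_EFinP.
      exact: measurable_sector_mass.
    - move=> a _; rewrite -EFinD -EFinM lee_fin /opp (mulrC (dot a f)).
      case: ifPn => [pq|_].
        apply: opposite_signs_sector => //.
        + rewrite -dsum -norm2_sqr -exprMn /b dotZr -dotDr mulrA mulfV ?mul1r//.
          by rewrite gt_eqF ?norm2_gt0.
        + rewrite -ddif -norm2_sqr -exprMn /g dotZr -dotNr -dotDr mulrA.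
          by rewrite mulfV ?mul1r// gt_eqF ?norm2_gt0.
      rewrite addr0 mulr_ge0 ?sector_mass_ge0// subr_ge0 expr_le1//; lra.
  rewrite ge0_integralZl//; first last.
  - by rewrite lee_fin subr_ge0 expr_le1//; lra.
  - by move=> a _; rewrite lee_fin sector_mass_ge0.
  - by apply/measurable_EFinP; exact: measurable_sector_mass.
  rewrite EFinM lee_pmul2l//; last by rewrite lte_fin subr_gt0 expr_lt1//; lra.
  by apply: sector_moment => //; exact: dot_normalize.
have -> : S = (2^-1%:E * (2%:R%:E * S))%E.
  by rewrite muleA -EFinM mulVf ?mul1e.
have -> : ((1 - c ^+ 2) / (5 * n%:R))%:E =
    (2^-1%:E * ((1 - c ^+ 2) * (2 / (5 * n%:R)))%:E)%E.
  by rewrite -EFinM; congr EFin; field; rewrite pnatr_eq0 -lt0n.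
by rewrite lee_pmul2l ?lte_fin ?invr_gt0 ?ltr0n// mule_natl mule2n.
Qed.

End Contraction.

(** * The constants attached to the angle pi / 8 *)

Section Trigonometry.
Context {R : realType}.
Implicit Types t : R.

(** Gives positivity of alpha_sigma, which amounts to
    sin (pi / 8) < pi / 8. *)
Lemma sin_lt_id t : 0 < t -> sin t < t.
Proof.
move=> t0; have [t1|t1] := ltP 1 t; first by rewrite (le_lt_trans (sin_le1 t)).
have dsin (z : R) : z \in `]0, t[ -> is_derive z 1 sin (cos z).
  by move=> _; exact: is_derive_sin.
have [|c] := MVT t0 dsin.
  by apply: continuous_subspaceT => z; exact: continuous_sin.
rewrite in_itv/= sin0 !subr0 => /andP[c0 ct] ->.
rewrite gtr_pMl// -cos0 ltr_cos// in_itv/= ?lexx ?pi_ge0//.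
rewrite ltW//= (le_trans (ltW ct))// (le_trans t1)//.
by rewrite (le_trans _ (pi_ge2 R)) ?ler1n.
Qed.

Lemma pi8_itv : 0 <= (pi / 8 : R) <= pi / 2.
Proof. have := @pi_gt0 R; lra. Qed.

Lemma sqr_cos_pi4 : cos (pi / 4) ^+ 2 = 2^-1 :> R.
Proof.
have := @cos_mulr2n R (pi / 4).
have -> : pi / 4 *+ 2 = pi / 2 :> R by field.
rewrite cos_pihalf; lra.
Qed.

Lemma sqr_cos_pi8 : cos (pi / 8) ^+ 2 = (1 + cos (pi / 4)) / 2 :> R.
Proof.
have := @cos_mulr2n R (pi / 8).
have -> : pi / 8 *+ 2 = pi / 4 :> R by field.
lra.
Qed.

Lemma cos_pi4_bounds : 7 / 10 <= (cos (pi / 4) : R) <= 3 / 4.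
Proof.
have c0 : 0 <= cos (pi / 4) :> R.
  by apply: cos_ge0_pihalf; have := @pi_gt0 R; lra.
have c2 := sqr_cos_pi4.
by apply/andP; split; rewrite -(@ler_pXn2r R 2)// ?nnegrE// ?c2; lra.
Qed.

Lemma cos_pi8_ge : 23 / 25 <= cos (pi / 8) :> R.
Proof.
have c0 : 0 <= cos (pi / 8) :> R by apply: cos_ge0_pihalf; have := pi8_itv; lra.
rewrite -(@ler_pXn2r R 2)// ?nnegrE// sqr_cos_pi8.
by have := cos_pi4_bounds; lra.
Qed.

Lemma sin_pi8_gt0 : 0 < sin (pi / 8) :> R.
Proof. by apply: sin_gt0_pihalf; have := @pi_gt0 R; lra. Qed.

Lemma sin_pi8_ge : 3 / 10 <= sin (pi / 8) :> R.
Proof.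
rewrite -(@ler_pXn2r R 2)// ?nnegrE ?(ltW sin_pi8_gt0)//.
have := cos2Dsin2 (pi / 8 : R); rewrite sqr_cos_pi8.
have := cos_pi4_bounds; lra.
Qed.

Lemma alpha_sigma_gt0 : 0 < alpha_sigma R.
Proof.
rewrite /alpha_sigma subr_gt0 ltr_pdivrMr ?pi_gt0//.
have : sin (pi / 8) < pi / 8 :> R by apply: sin_lt_id; have := @pi_gt0 R; lra.
lra.
Qed.

Lemma alpha_sigma_le : alpha_sigma R <= 5^-1.
Proof.
rewrite /alpha_sigma lerBlDr -lerBlDl ler_pdivlMr ?pi_gt0//.
have := sin_pi8_ge; have := @pihalf_lt2 R; lra.
Qed.

End Trigonometry.

(** * The cone around the signal *)

Section AngularBall.
Context {R : realType} {n : nat}.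
Implicit Types (x y : 'rV[R]_n) (theta : R).

Lemma dot_le_norm2 x y : x != 0 -> y != 0 ->
  -1 <= dot x y / (norm2 x * norm2 y) <= 1.
Proof.
move=> x0 y0.
have -> : dot x y / (norm2 x * norm2 y) =
    dot ((norm2 x)^-1 *: x) ((norm2 y)^-1 *: y).
  by rewrite dotZl dotZr invfM mulrC mulrA.
by rewrite unit_dot_le1 ?unit_dot_ge1// dot_normalize.
Qed.

Lemma angular_ballP theta x y : 0 <= theta <= pi -> x != 0 ->
  angular_ball x theta y <->
  y != 0 /\ cos theta * (norm2 y * norm2 x) <= dot y x.
Proof.
move=> th x0; rewrite /angular_ball/= /angle.
suff angleE : y != 0 ->
    (acos (dot y x / (norm2 y * norm2 x)) <= theta) =
    (cos theta * (norm2 y * norm2 x) <= dot y x).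
  by split=> -[y0]; rewrite angleE.
move=> y0; set t := _ / _; have tb : -1 <= t <= 1 := dot_le_norm2 y x y0 x0.
rewrite -ler_pdivlMr ?mulr_gt0 ?norm2_gt0// -/t.
have tK : cos (acos t) = t by rewrite acosK ?in_itv.
rewrite !leNgt -[in RHS]tK ltr_cos// in_itv//=.
by rewrite acos_ge0 ?acos_lepi.
Qed.

Lemma measurable_angular_ball theta x : 0 <= theta <= pi -> x != 0 ->
  measurable (angular_ball x theta : set (borel_rV R n)).
Proof.
move=> th x0.
have mdot (v : 'rV[R]_n) : measurable_fun setT
    (fun y : borel_rV R n => dot (y : 'rV[R]_n) v) by exact: measurable_dotr.
have mnorm : measurable_fun setT (fun y : borel_rV R n => norm2 (y : 'rV[R]_n)).
  have mdd : measurable_fun setT (fun y : borel_rV R n => dot (y : 'rV[R]_n) y).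
    exact: measurable_dot.
  apply: (measurableT_comp _ mdd).
  exact: continuous_measurable_fun (@sqrt_continuous R).
have : measurable_fun setT (fun y : borel_rV R n =>
    ~~ (dot (y : 'rV[R]_n) y == 0) &&
    (cos theta * (norm2 (y : 'rV[R]_n) * norm2 x) <= dot (y : 'rV[R]_n) x)).
  apply: measurable_and.
    apply: measurable_neg; apply: measurable_fun_eqr => //.
    exact: measurable_dot.
  apply: measurable_fun_ler => //.
  by apply: measurable_funM => //; exact: measurable_funM.
move=> /(_ measurableT [set true] I); rewrite setTI; congr (measurable _).
apply/seteqP; split => y /=.
  by rewrite dot_eq0 => /andP yB; apply/angular_ballP.
by move/angular_ballP => /(_ th x0) yB; rewrite dot_eq0; apply/andP.
Qed.

Lemma dot_sub x y : dot (y - x) (y - x) =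
  norm2 y ^+ 2 + norm2 x ^+ 2 - 2 * dot y x.
Proof. by rewrite !dotE !norm2_sqr (dotC x y); ring. Qed.

(** Rays at angle theta from x are at distance sin theta |x| from x, and the
    points at a larger angle, like the origin, are at least as far. *)
Lemma angular_ball_exit theta x y : 0 <= theta <= pi / 2 -> x != 0 ->
  ~ angular_ball x theta y -> (sin theta * norm2 x) ^+ 2 <= dot (y - x) (y - x).
Proof.
move=> th x0 yB; have pi0 := @pi_gt0 R.
have c0 : 0 <= cos theta by apply: cos_ge0_pihalf; lra.
have xy : dot y x <= cos theta * (norm2 y * norm2 x).
  have [->|y0] := eqVneq y 0.
    rewrite -(scale0r 0) dotZl mul0r !mulr_ge0 ?norm2_ge0//.
  rewrite leNgt; apply/negP => /ltW xy; apply: yB; apply/angular_ballP => //.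
  lra.
rewrite dot_sub exprMn; have := cos2Dsin2 theta.
have := sqr_ge0 (norm2 y - cos theta * norm2 x).
nra.
Qed.

End AngularBall.

(** * One Kaczmarz step contracts inside the cone *)

Section Step.
Context {R : realType} {n : nat}.
Implicit Types (a x y : 'rV[R]_n).

Lemma measurable_sqdist d (T : measurableType d) (f : T -> borel_rV R n) x :
  measurable_fun setT f ->
  measurable_fun setT
    (fun t => dot ((f t : 'rV[R]_n) - x) ((f t : 'rV[R]_n) - x)).
Proof.
move=> mf.
have mfx : measurable_fun setT (fun t => (f t : 'rV[R]_n) - x : borel_rV R n).
  apply: measurable_rV => i; under eq_fun do rewrite !mxE.
  apply: measurable_funB => //.
  exact: measurableT_comp (measurable_entry i) mf.
exact: measurable_dot.
Qed.

(** With equal signs the error loses its component along a; with opposite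
    signs the step ends on the hyperplane a.u = - a.x, at distance 2 |a.x| from
    the one containing x.  If a.y = 0 the step does nothing, which costs
    only (a.x)^2. *)
Lemma kaczmarz_step_error a x y : dot a a = 1 ->
  dot (kaczmarz_step x a y - x) (kaczmarz_step x a y - x) + dot a (y - x) ^+ 2
  <= dot (y - x) (y - x) +
     4 * (if dot a x * dot a y <= 0 then dot a x ^+ 2 else 0).
Proof.
move=> a1; rewrite /kaczmarz_step addrAC.
have : dot a (y - x) = dot a y - dot a x by rewrite !dotE.
move: (y - x) => z az; set s := (X in _ + X *: a).
have -> : dot (z + s *: a) (z + s *: a) = dot z z + 2 * s * dot a z + s ^+ 2.
  by rewrite !dotE a1 (dotC z a); ring.
rewrite az {}/s; move: (dot a x) (dot a y) => p q.
have [q0|q0|->] := ltgtP q 0; last first.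
- by rewrite sgr0 mulr0 lexx mul0r !subr0 sub0r sqrrN; have := sqr_ge0 p; lra.
- rewrite gtr0_sg// pmulr_lle0// mul1r.
  by case: ler0P => p0; lra.
- rewrite ltr0_sg// nmulr_lle0// mulN1r.
  by case: ger0P => p0; lra.
Qed.

End Step.

Lemma contraction_rate_ge0 (R : realType) (n : nat) : (0 < n)%N ->
  0 <= 1 - (5 * n%:R)^-1 :> R.
Proof.
move=> n0; have n1 : 1 <= n%:R :> R by rewrite ler1n.
rewrite subr_ge0 invf_le1; lra.
Qed.

Lemma contraction_rate_le1 (R : realType) (n : nat) :
  1 - (5 * n%:R)^-1 <= 1 :> R.
Proof. by rewrite gerBl invr_ge0 mulr_ge0. Qed.

Section StepContraction.
Context {R : realType} {n : nat} (mu : probability (borel_rV R n) R).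
Hypothesis mu_unif : uniform_on_sphere mu.
Hypothesis n_gt0 : (0 < n)%N.
Implicit Types x y : 'rV[R]_n.

(** The gain |z|^2 / n outweighs the loss 4 |z|^2 / (5 n). *)
Lemma step_contraction x y : x != 0 -> y != 0 ->
  23 / 25 * (norm2 y * norm2 x) <= dot y x ->
  (\int[mu]_a (dot (kaczmarz_step x (a : 'rV[R]_n) y - x)
                   (kaczmarz_step x (a : 'rV[R]_n) y - x))%:E
   <= ((1 - (5 * n%:R)^-1) * dot (y - x) (y - x))%:E)%E.
Proof.
move=> x0 y0 yx; set I := (\int[mu]_a _)%E; set N := dot (y - x) (y - x).
pose e := (norm2 x)^-1 *: x; pose f := (norm2 y)^-1 *: y; pose c := dot e f.
have nx : 0 < norm2 x by rewrite norm2_gt0.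
have ny : 0 < norm2 y by rewrite norm2_gt0.
have xE : x = norm2 x *: e by rewrite scalerA mulfV ?scale1r// gt_eqF.
have yE : y = norm2 y *: f by rewrite scalerA mulfV ?scale1r// gt_eqF.
have yxc : dot y x = norm2 y * norm2 x * c.
  by rewrite {1}yE {1}xE dotZl dotZr (dotC f e) -/c mulrA.
have c_ge : 23 / 25 <= c.
  by move: yx; rewrite yxc mulrC ler_pM2l// mulr_gt0.
(* The left-hand side is the squared distance from x to the line of y. *)
have N_ge : norm2 x ^+ 2 * (1 - c ^+ 2) <= N.
  rewrite /N dot_sub yxc; have := sqr_ge0 (norm2 y - c * norm2 x); lra.
pose W (a : borel_rV R n) : R :=
  if dot (a : 'rV[R]_n) e * dot (a : 'rV[R]_n) f <= 0
  then dot (a : 'rV[R]_n) e ^+ 2 else 0.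
have W0 a : 0 <= W a by rewrite /W; case: ifP; rewrite ?sqr_ge0.
have mW : measurable_fun setT (fun a => (W a)%:E).
  apply/measurable_EFinP; apply: measurable_fun_ifT => //.
    apply: measurable_fun_ler => //.
    by apply: measurable_funM; exact: measurable_dotr.
  by apply: measurable_funX; exact: measurable_dotr.
have mstep : measurable_fun setT (fun a : borel_rV R n =>
    (dot (kaczmarz_step x (a : 'rV[R]_n) y - x)
         (kaczmarz_step x (a : 'rV[R]_n) y - x))%:E).
  apply/measurable_EFinP; apply: measurable_sqdist.
  exact: (@measurable_kaczmarz_step _ _ _ _ x id (cst y)).
have mproj : measurable_fun setT (fun a : borel_rV R n =>
    (dot (a : 'rV[R]_n) (y - x) ^+ 2)%:E).
  by apply/measurable_EFinP; apply: measurable_funX; exact: measurable_dotr.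
have WE (a : borel_rV R n) :
    (if dot (a : 'rV[R]_n) x * dot (a : 'rV[R]_n) y <= 0
     then dot (a : 'rV[R]_n) x ^+ 2 else 0) = norm2 x ^+ 2 * W a.
  have ax : dot (a : 'rV[R]_n) x = norm2 x * dot (a : 'rV[R]_n) e.
    by rewrite {1}xE dotZr.
  have ay : dot (a : 'rV[R]_n) y = norm2 y * dot (a : 'rV[R]_n) f.
    by rewrite {1}yE dotZr.
  rewrite ax ay mulrACA pmulr_rle0 ?mulr_gt0// /W.
  by case: ifP => _; rewrite ?mulr0// exprMn.
have : (I + (N / n%:R)%:E <=
    N%:E + (4 * norm2 x ^+ 2)%:E * \int[mu]_a (W a)%:E)%E.
  rewrite -(second_moment mu mu_unif (y - x) n_gt0).
  rewrite -ge0_integralD//; first last.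
  - by move=> a _; rewrite lee_fin sqr_ge0.
  - by move=> a _; rewrite lee_fin dot_ge0.
  have -> : (N%:E + (4 * norm2 x ^+ 2)%:E * \int[mu]_a (W a)%:E =
      \int[mu]_a (N%:E + (4 * norm2 x ^+ 2)%:E * (W a)%:E))%E.
    rewrite ge0_integralD//; first last.
    - by apply: measurable_funeM.
    - by move=> a _; rewrite -EFinM lee_fin !mulr_ge0 ?norm2_ge0 ?W0.
    - by move=> a _; rewrite lee_fin dot_ge0.
    rewrite ge0_integralZl//; first last.
    - by rewrite lee_fin !mulr_ge0 ?norm2_ge0.
    - by move=> a _; rewrite lee_fin W0.
    by rewrite (integral_cst_probability _ _ _ mu).
  apply: ae_ge0_le_integral => //.
  - by move=> a _; apply: adde_ge0; rewrite lee_fin ?dot_ge0 ?sqr_ge0.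
  - exact: emeasurable_funD.
  - move=> a _; apply: adde_ge0; rewrite -?EFinM lee_fin ?dot_ge0//.
    by rewrite !mulr_ge0 ?norm2_ge0 ?W0.
  - by apply: emeasurable_funD => //; exact: measurable_funeM.
  apply: negligibleS (uniform_ae_unit _ mu_unif) => a /= + a1; apply => _.
  rewrite -EFinM -!EFinD lee_fin -mulrA -WE.
  exact: kaczmarz_step_error.
have [ee ff] : dot e e = 1 /\ dot f f = 1 by split; exact: dot_normalize.
have := opposite_signs_moment mu mu_unif n_gt0 e f ee ff c_ge.
rewrite -/c -/(W _) => W_le I_le.
have : (I + (N / n%:R)%:E <=
    (N + 4 * norm2 x ^+ 2 * ((1 - c ^+ 2) / (5 * n%:R)))%:E)%E.
  apply: (le_trans I_le); rewrite EFinD leeD2l//.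
  rewrite [X in (_ <= X)%E]EFinM; apply: lee_wpmul2l => //.
  by rewrite lee_fin !mulr_ge0 ?norm2_ge0.
rewrite -leeBrDr// => /le_trans; apply; rewrite -EFinB lee_fin.
have n0 : 0 < n%:R :> R by rewrite ltr0n.
have : norm2 x ^+ 2 * (1 - c ^+ 2) * (4 / (5 * n%:R)) <= N * (4 / (5 * n%:R)).
  by rewrite ler_wpM2r// divr_ge0// mulr_ge0// ltW.
rewrite !invfM; lra.
Qed.

End StepContraction.

(** * Recursions driven by independent noise *)

Lemma measure_eq_rectangles (R : realType) d1 d2 (T1 : measurableType d1)
    (T2 : measurableType d2) (m m' : {measure set (T1 * T2) -> \bar R}) :
  (m setT < +oo)%E ->
  (forall A B, measurable A -> measurable B -> m (A `*` B) = m' (A `*` B)) ->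
  forall E, measurable E -> m E = m' E.
Proof.
move=> moo mm' E mE.
pose C : set (set (T1 * T2)) :=
  [set A `*` B | A in measurable & B in measurable].
apply: (measure_unique C (fun=> setT)) => //.
- exact: measurable_prod_measurableType.
- move=> _ _ [A1 mA1 [B1 mB1 <-]] [A2 mA2 [B2 mB2 <-]].
  rewrite -setXI; exists (A1 `&` A2); first exact: measurableI.
  by exists (B1 `&` B2); first exact: measurableI.
- by move=> _; exists setT => //; exists setT => //; rewrite setXTT.
- by rewrite bigcup_const.
- by move=> _ [A mA [B mB <-]]; exact: mm'.
Qed.

(** The noise used to reach state k.+1 is a k, so the state at time k depends on
    a 0, ..., a k.-1 only. *)
Fixpoint driven_chain {S E : Type} (f : E -> S -> S) (s0 : S) (a : nat -> E)
    (k : nat) : S :=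
  if k is k'.+1 then f (a k') (driven_chain f s0 a k') else s0.

Section DrivenChain.
Context (R : realType) d (T : measurableType d) (P : probability T R).
Context dS (S : measurableType dS) dE (E : measurableType dE).
Variables (f : E -> S -> S) (s0 : S) (a : nat -> {RV P >-> E}).
Hypothesis mf : measurable_fun setT (fun z : S * E => f z.2 z.1).
Hypothesis a_indep : mutually_independent a.

Local Notation Z k := (fun w => driven_chain f s0 (fun j => a j w) k).

Lemma measurable_driven_chain k : measurable_fun setT (Z k).
Proof.
elim: k => [|k IH] /=; first exact: measurable_cst.
exact: (measurableT_comp mf (measurable_fun_pair IH (measurable_funPT (a k)))).
Qed.

Lemma measurable_state_noise k : measurable_fun setT (fun w => (Z k w, a k w)).
Proof.
apply: measurable_fun_pair; last exact: measurable_funPT.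
exact: measurable_driven_chain.
Qed.

(** The state at time k is independent of the noises from index k on.  The
    induction step compares two measures on pairs (state, noise): the joint law
    of the state and noise at time k, and its restriction to an event F about
    later noises.  By induction the second is P F times the first on rectangles,
    hence on every measurable set, in particular on the set of pairs that the
    recursion sends into D. *)
Lemma driven_chain_indep k D (J : seq nat) (A : nat -> set E) :
  measurable D -> uniq J -> all (leq k) J -> (forall j, measurable (A j)) ->
  P ((Z k @^-1` D) `&` \bigcap_(j in [set` J]) (a j @^-1` A j)) =
  (P (Z k @^-1` D) * \prod_(j <- J) P (a j @^-1` A j))%E.
Proof.
elim: k D J A => [|k IH] D J A mD uJ kJ mA.
  rewrite /= preimage_cst; case: ifPn => _.
    by rewrite setTI probability_setT mul1e a_indep.
  by rewrite set0I measure0 mul0e.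
pose F := \bigcap_(j in [set` J]) (a j @^-1` A j).
have mF : measurable F.
  by apply: bigcap_measurableType => j _; rewrite -[X in measurable X]setTI;
    apply: measurable_funPT.
have PF : P F = (\prod_(j <- J) P (a j @^-1` A j))%E by exact: a_indep.
have mZa := measurable_state_noise k.
pose Za : {mfun T >-> (S * E)%type} :=
  HB.pack (fun w => (Z k w, a k w)) (isMeasurableFun.Build _ _ _ _ _ mZa).
have [law_F law_FE] : exists m : {measure set (S * E) -> \bar R},
    forall X, m X = P (Za @^-1` X `&` F).
  by unshelve eexists
    (pushforward (mrestr P mF) Za : {measure set (S * E) -> \bar R}).
pose pF : {nonneg R} := NngNum (fine_ge0 (measure_ge0 P F)).
have pFE : (pF%:num%:E = P F)%E by rewrite [LHS]fineK// fin_num_measure.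
have kNJ : k \notin J by apply/negP => /(allP kJ); rewrite ltnn.
have kJ' : all (leq k) J by apply: sub_all kJ => j; exact: ltnW.
have rectE B C (K : seq nat) (A' := fun j => if j == k then C else A j) :
    measurable B -> measurable C -> uniq K -> all (leq k) K -> k \notin K ->
    P ((Z k @^-1` B `&` a k @^-1` C) `&`
       \bigcap_(j in [set` K]) (a j @^-1` A j)) =
    (P (Z k @^-1` B) * P (a k @^-1` C) * \prod_(j <- K) P (a j @^-1` A j))%E.
  move=> mB mC uK kK kNK.
  have A'K j : j \in K -> A' j = A j.
    by rewrite /A'; case: eqP => // -> kK'; rewrite kK' in kNK.
  have -> : (Z k @^-1` B `&` a k @^-1` C) `&`
      \bigcap_(j in [set` K]) (a j @^-1` A j) =
      Z k @^-1` B `&` \bigcap_(j in [set` k :: K]) (a j @^-1` A' j).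
    rewrite [in RHS]bigcap_seq big_cons -bigcap_seq -setIA {1}/A' eqxx.
    by congr (_ `&` (_ `&` _)); apply: eq_bigcapr => j /= jK; rewrite A'K.
  rewrite IH//=; first last.
  - by move=> j; rewrite /A'; case: ifP.
  - by rewrite leqnn.
  - by rewrite kNK.
  rewrite big_cons {1}/A' eqxx muleA; congr (_ * _)%E.
  by apply: eq_big_seq => j jK; rewrite A'K.
have scaleE X : mscale pF (distribution P Za) X = (P F * P (Za @^-1` X))%E.
  by rewrite -pFE.
have law_eq X : measurable X -> law_F X = (P F * P (Za @^-1` X))%E.
  move=> mX; rewrite -scaleE; move: X mX.
  apply: measure_eq_rectangles => [|B C mB mC].
    rewrite law_FE preimage_setT setTI.
    by rewrite (le_lt_trans (probability_le1 P mF)) ?ltry.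
  rewrite law_FE [RHS]scaleE.
  have -> : Za @^-1` (B `*` C) = Z k @^-1` B `&` a k @^-1` C by [].
  rewrite rectE// PF muleC; congr (_ * _)%E.
  have := rectE B C [::] mB mC isT isT isT.
  by rewrite bigcap_seq !big_nil setIT mule1.
have mE : measurable ((fun z : S * E => f z.2 z.1) @^-1` D).
  by rewrite -[X in measurable X]setTI; exact: mf.
by have := law_eq _ mE; rewrite law_FE PF muleC.
Qed.

Lemma driven_chain_integral k (g : S * E -> \bar R) :
  measurable_fun setT g -> (forall z, 0 <= g z)%E ->
  (\int[P]_w g (Z k w, a k w) =
   \int[P]_w \int[distribution P (a k)]_e g (Z k w, e))%E.
Proof.
move=> mg g0; have mZ := measurable_driven_chain k.
pose Zk : {mfun T >-> S} := HB.pack (Z k) (isMeasurableFun.Build _ _ _ _ _ mZ).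
have mZa := measurable_state_noise k.
transitivity (\int[pushforward P (fun w => (Z k w, a k w))]_z g z)%E.
  by rewrite (ge0_integral_pushforward mZa).
transitivity (\int[distribution P Zk \x distribution P (a k)]_z g z)%E.
  apply: eq_measure_integral => X mX _; apply/esym.
  apply: product_measure_unique => // A B mA mB.
  have := @driven_chain_indep k A [:: k] (fun=> B) mA isT.
  rewrite bigcap_seq !big_seq1/= leqnn; exact.
rewrite fubini_tonelli1// /fubini_F.
transitivity (\int[pushforward P (Z k)]_s
    \int[distribution P (a k)]_e g (s, e))%E; first by [].
rewrite (ge0_integral_pushforward mZ)//.
  exact: (measurable_fun_fubini_tonelli_F _ mg g0).
by move=> s _; apply: integral_ge0.
Qed.

(** A bound on the conditional mean given the state, uniform in the state,
    holds on average along the recursion. *)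
Lemma driven_chain_drift k (phi : S * E -> \bar R) (psi : S -> \bar R) :
  measurable_fun setT phi -> (forall z, 0 <= phi z)%E ->
  measurable_fun setT psi ->
  (forall s, \int[distribution P (a k)]_e phi (s, e) <= psi s)%E ->
  (\int[P]_w phi (Z k w, a k w) <= \int[P]_w psi (Z k w))%E.
Proof.
move=> mphi phi0 mpsi drift; rewrite driven_chain_integral//.
have mZ := measurable_driven_chain k.
apply: ge0_le_integral => //.
- by move=> w _; apply: integral_ge0.
- exact: (measurableT_comp (measurable_fun_fubini_tonelli_F _ mphi phi0) mZ).
- exact: measurableT_comp.
Qed.

End DrivenChain.

(** * Stopping a recursion when it leaves a set *)

Section StoppedChain.
Context {S E : Type} (f : E -> S -> S) (B : set S).

Definition stop_at_exit (e : E) (s : S) : S := if `[< B s >] then f e s else s.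

(** Frozen outside B, the stopped recursion is in B at time k exactly when the
    original one has not left B up to time k, and then the two agree. *)
Lemma stopped_chainP s0 a k :
  (B (driven_chain stop_at_exit s0 a k) <->
   forall j, (j <= k)%N -> B (driven_chain f s0 a j)) /\
  ((forall j, (j <= k)%N -> B (driven_chain f s0 a j)) ->
   driven_chain stop_at_exit s0 a k = driven_chain f s0 a k).
Proof.
elim: k => [|k [IHB IHE]] /=.
  by split=> //; split=> [B0 [|j]//|/(_ 0%N isT)].
have [inB|outB] := pselect (forall j, (j <= k)%N -> B (driven_chain f s0 a j)).
  have -> : stop_at_exit (a k) (driven_chain stop_at_exit s0 a k) =
            driven_chain f s0 a k.+1.
    by rewrite /stop_at_exit asboolT ?IHE// -IHE// IHB.
  split=> //; split=> [Bk j|/(_ k.+1 (leqnn _))//].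
  by rewrite leq_eqVlt => /orP[/eqP ->//|]; exact: inB.
have outB' : ~ forall j, (j <= k.+1)%N -> B (driven_chain f s0 a j).
  by move=> inB; apply: outB => j jk; exact: inB (leqW jk).
split=> //; split=> //.
rewrite /stop_at_exit; case: asboolP => [/IHB//|nB /nB//].
Qed.

End StoppedChain.

Section ExitTime.
Context {R : realType} {n : nat} (B : set 'rV[R]_n) (X : nat -> 'rV[R]_n).

Lemma exit_time_infinite : exit_time B X = +oo%E <-> forall k, B (X k).
Proof.
rewrite /exit_time; case: pselect => [[k nBk]|inB]; split=> //.
- by move=> /(_ k) Bk; have /asboolP := nBk.
- by move=> _ k; apply: contrapT => nBk; apply: inB; exists k; apply/asboolP.
Qed.

Lemma exit_time_finite : (exit_time B X < +oo)%E <-> exists k, ~ B (X k).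
Proof.
rewrite /exit_time; case: pselect => [ex|inB]; split=> //.
- by move: ex => [k /asboolP nBk] _; exists k.
- by rewrite ltry.
- by move=> [k nBk]; case: inB; exists k; apply/asboolP.
Qed.

End ExitTime.

Lemma kaczmarz_driven (R : realType) n (x x0 : 'rV[R]_n)
    (a : nat -> 'rV[R]_n) k :
  kaczmarz x x0 a k = driven_chain (kaczmarz_step x) x0 a k.
Proof. by elim: k => //= k ->. Qed.

(** * The Kaczmarz iteration stopped at its exit from the cone *)

Section StoppedKaczmarz.
Context {R : realType} {n : nat} (x x0 : 'rV[R]_n).
Context d (T : measurableType d) (P : probability T R).
Context (a : nat -> {RV P >-> borel_rV R n}).
Hypothesis x_neq0 : x != 0.
Hypothesis a_indep : mutually_independent a.
Hypothesis a_unif : forall j, uniform_on_sphere (distribution P (a j)).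

Local Notation B := (angular_ball x (pi / 8)).
Definition sqdist (s : 'rV[R]_n) : R := dot (s - x) (s - x).
Definition sqdist_inside (s : 'rV[R]_n) : R :=
  if `[< B s >] then sqdist s else 0.

(** The iterate at time min (k, tau). *)
Definition stopped_kaczmarz (k : nat) (w : T) : borel_rV R n :=
  driven_chain (stop_at_exit (kaczmarz_step x) B) x0 (fun j => a j w) k.

Lemma dim_gt0 : (0 < n)%N.
Proof.
by case: n x x_neq0 => // y; rewrite (thinmx0 y) eqxx.
Qed.

Lemma pi8_le_pi : 0 <= (pi / 8 : R) <= pi.
Proof. have := @pi_gt0 R; lra. Qed.

Lemma measurable_stop_at_exit : measurable_fun setT
  (fun z : borel_rV R n * borel_rV R n =>
     stop_at_exit (kaczmarz_step x) B z.2 z.1 : borel_rV R n).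
Proof.
apply: measurable_fun_ifT => //.
- apply: (measurable_fun_bool true).
  have mB := measurable_angular_ball _ x pi8_le_pi x_neq0.
  have := measurable_fst (T1 := borel_rV R n) (T2 := borel_rV R n).
  move=> /(_ measurableT _ mB); congr (measurable (_ `&` _)).
  by apply/seteqP; split => z /asboolP.
- apply: measurable_kaczmarz_step; first exact: measurable_snd.
  exact: measurable_fst.
Qed.

Lemma measurable_stopped k : measurable_fun setT (stopped_kaczmarz k).
Proof. exact: measurable_driven_chain measurable_stop_at_exit k. Qed.

(** The state and noise spaces are given explicitly because the measurable
    structure is carried by borel_rV R n, not by 'rV[R]_n. *)
Definition stopped_drift k := @driven_chain_drift R _ T P _ (borel_rV R n) _
  (borel_rV R n) (stop_at_exit (kaczmarz_step x) B) x0 a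
  measurable_stop_at_exit a_indep k.

Lemma measurable_ball_preimage d' (U : measurableType d')
    (h : U -> borel_rV R n) :
  measurable_fun setT h -> measurable [set u | B (h u)].
Proof.
move=> mh; have mB := measurable_angular_ball _ x pi8_le_pi x_neq0.
by have := mh measurableT _ mB; rewrite setTI.
Qed.

Lemma measurable_sqdist_fun d' (U : measurableType d') (h : U -> borel_rV R n) :
  measurable_fun setT h -> measurable_fun setT (fun u => (sqdist (h u))%:E).
Proof. by move=> mh; apply/measurable_EFinP; exact: measurable_sqdist. Qed.

Lemma measurable_sqdist_inside d' (U : measurableType d')
    (h : U -> borel_rV R n) :
  measurable_fun setT h ->
  measurable_fun setT (fun u => (sqdist_inside (h u))%:E).
Proof.
move=> mh; apply/measurable_EFinP; apply: measurable_fun_ifT => //.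
  apply: (measurable_fun_bool true); rewrite setTI.
  have := measurable_ball_preimage _ _ _ mh; congr (measurable _).
  by apply/seteqP; split => u /asboolP.
exact: measurable_sqdist.
Qed.

Lemma sqdist_inside_ge0 s : 0 <= sqdist_inside s.
Proof. by rewrite /sqdist_inside; case: ifP => // _; exact: dot_ge0. Qed.

Lemma ball_step_contraction j (s : 'rV[R]_n) : B s ->
  (\int[distribution P (a j)]_e (sqdist (kaczmarz_step x (e : 'rV[R]_n) s))%:E
   <= ((1 - (5 * n%:R)^-1) * sqdist s)%:E)%E.
Proof.
move=> /(angular_ballP _ _ _ pi8_le_pi x_neq0) [s0 xs].
apply: (step_contraction _ (a_unif j) dim_gt0 _ _ x_neq0 s0).
apply: le_trans xs; apply: ler_wpM2r; last exact: cos_pi8_ge.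
by rewrite mulr_ge0 ?norm2_ge0.
Qed.

Lemma measurable_step_sqdist (s : 'rV[R]_n) : measurable_fun setT
  (fun e : borel_rV R n => (sqdist (kaczmarz_step x (e : 'rV[R]_n) s))%:E).
Proof.
apply: measurable_sqdist_fun.
exact: (@measurable_kaczmarz_step _ _ _ _ x id (cst s)).
Qed.

(** Only trajectories that stay in the cone count, and each of their steps is
    taken from inside the cone. *)
Lemma inside_sqdist_decay k :
  (\int[P]_w (sqdist_inside (stopped_kaczmarz k w))%:E
   <= ((1 - (5 * n%:R)^-1) ^+ k * sqdist x0)%:E)%E.
Proof.
elim: k => [|k IH].
  rewrite expr0 mul1r.
  rewrite (integral_cst_probability _ _ _ P (sqdist_inside x0)%:E).
  rewrite lee_fin /sqdist_inside.
  by case: ifP => // _; exact: dot_ge0.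
rewrite exprS -mulrA EFinM.
apply: (@le_trans _ _ (\int[P]_w ((1 - (5 * n%:R)^-1)%:E *
    (sqdist_inside (stopped_kaczmarz k w))%:E))%E); last first.
  rewrite ge0_integralZl//.
  - by apply: lee_wpmul2l => //; rewrite lee_fin contraction_rate_ge0// dim_gt0.
  - by apply: measurable_sqdist_inside; exact: measurable_stopped.
  - by move=> w _; rewrite lee_fin sqdist_inside_ge0.
  - by rewrite lee_fin contraction_rate_ge0// dim_gt0.
apply: (stopped_drift k
  (fun z => (sqdist_inside (stop_at_exit (kaczmarz_step x) B z.2 z.1))%:E)
  (fun s => (1 - (5 * n%:R)^-1)%:E * (sqdist_inside s)%:E)%E).
- by apply: measurable_sqdist_inside; exact: measurable_stop_at_exit.
- by move=> z; rewrite lee_fin sqdist_inside_ge0.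
- apply: measurable_funeM; apply: measurable_sqdist_inside.
  exact: measurable_id.
move=> s /=; rewrite /stop_at_exit {2}/sqdist_inside; case: asboolP => Bs.
  rewrite -EFinM; apply: le_trans (ball_step_contraction k s Bs).
  apply: ge0_le_integral => //.
  - by move=> e _; rewrite lee_fin sqdist_inside_ge0.
  - apply: measurable_sqdist_inside.
    exact: (@measurable_kaczmarz_step _ _ _ _ x id (cst s)).
  - exact: measurable_step_sqdist.
  - move=> e _; rewrite lee_fin /sqdist_inside.
    by case: ifP => // _; exact: dot_ge0.
rewrite integral0_eq ?mule0// => e _.
by rewrite /sqdist_inside asboolF.
Qed.

(** Inside the cone a step contracts on average, outside nothing moves. *)
Lemma stopped_sqdist_le k :
  (\int[P]_w (sqdist (stopped_kaczmarz k w))%:E <= (sqdist x0)%:E)%E.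
Proof.
elim: k => [|k IH].
  by rewrite (integral_cst_probability _ _ _ P (sqdist x0)%:E).
apply: le_trans IH.
apply: (stopped_drift k
  (fun z => (sqdist (stop_at_exit (kaczmarz_step x) B z.2 z.1))%:E)
  (fun s => (sqdist s)%:E)).
- by apply: measurable_sqdist_fun; exact: measurable_stop_at_exit.
- by move=> z; rewrite lee_fin dot_ge0.
- by apply: measurable_sqdist_fun; exact: measurable_id.
move=> s /=; rewrite /stop_at_exit; case: asboolP => Bs.
  apply: le_trans (ball_step_contraction k s Bs) _.
  by rewrite lee_fin ler_piMl ?contraction_rate_le1 ?dot_ge0.
by rewrite (integral_cst_probability _ _ _ (distribution P (a k))).
Qed.

(** Chebyshev's inequality: outside the cone the squared error is at least
    r2. *)
Lemma exit_probability_le k delta : 0 < delta ->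
  norm2 (x0 - x) <= delta * norm2 x ->
  (P [set w | ~ B (stopped_kaczmarz k w)]
   <= ((delta / sin (pi / 8)) ^+ 2)%:E)%E.
Proof.
move=> delta0 x0x; set out := [set w | _].
have mout : measurable out.
  rewrite (_ : out = ~` [set w | B (stopped_kaczmarz k w)])//.
  apply: measurableC; apply: measurable_ball_preimage.
  exact: measurable_stopped.
pose r2 : R := (sin (pi / 8) * norm2 x) ^+ 2.
have r20 : 0 < r2 by rewrite exprn_gt0// mulr_gt0 ?sin_pi8_gt0 ?norm2_gt0.
have : (r2%:E * P out <= (sqdist x0)%:E)%E.
  apply: le_trans (stopped_sqdist_le k).
  rewrite -[X in (_ * P X)%E]setIT -integral_indic//.
  rewrite -ge0_integralZl//; first last.
  - by rewrite lee_fin ltW.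
  - by apply/measurable_EFinP; exact: measurable_indic.
  apply: ge0_le_integral => //.
  - by move=> w _; rewrite -EFinM lee_fin mulr_ge0// ltW.
  - apply: measurable_funeM; apply/measurable_EFinP; exact: measurable_indic.
  - by apply: measurable_sqdist_fun; exact: measurable_stopped.
  move=> w _; rewrite -EFinM lee_fin indicE.
  case: (boolP (w \in out)) => [|_]; last by rewrite mulr0 dot_ge0.
  rewrite inE mulr1 => outw; apply: angular_ball_exit outw => //.
  exact: pi8_itv.
move=> /(lee_wpmul2l (x := r2^-1%:E)) => /(_ _)%E.
rewrite muleA -EFinM mulVf ?gt_eqF// mul1e => /(_ _)/le_trans; apply.
  by rewrite lee_fin invr_ge0 ltW.
rewrite -EFinM lee_fin mulrC ler_pdivrMr// /sqdist -norm2_sqr /r2 -exprMn mulrA.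
rewrite divfK ?gt_eqF ?sin_pi8_gt0//.
by rewrite ler_pXn2r// ?nnegrE ?norm2_ge0// mulr_ge0 ?norm2_ge0// ltW.
Qed.

End StoppedKaczmarz.

(** * Linear convergence and the exit probability *)

Theorem theorem3p1 (R : realType) (n : nat) (x x0 : 'rV[R]_n) (delta : R)
    (d : measure_display) (T : measurableType d) (P : probability T R)
    (a : nat -> {RV P >-> borel_rV R n})
    (x_neq0 : x != 0) (delta_gt0 : 0 < delta)
    (x0_close : norm2 (x0 - x) <= delta * norm2 x)
    (a_indep : mutually_independent a)
    (a_unif : forall j, uniform_on_sphere (distribution P (a j))) :
  let X (k : nat) (w : T) : 'rV[R]_n := kaczmarz x x0 (fun j => a j w) k in
  let B := angular_ball x (pi / 8) in
  let tau (w : T) : \bar R := exit_time B (fun k => X k w) in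
  [/\ 0 < alpha_sigma R,
      forall k : nat,
        ('E_P[(fun w => norm2 (X k w - x) ^+ 2
                        * \1_[set w' | tau w' = +oo%E] w)%R]
         <= ((1 - alpha_sigma R / n%:R) ^+ k * norm2 (x0 - x) ^+ 2)%R%:E)%E
    & (P [set w | tau w < +oo]%E <= ((delta / sin (pi / 8)) ^+ 2)%R%:E)%E].
Proof.
move=> X B tau; have n0 := dim_gt0 x x_neq0.
pose Z := stopped_kaczmarz x x0 d T P a.
have mZ k : measurable [set w | B (Z k w)].
  by apply: measurable_ball_preimage => //; exact: measurable_stopped.
(* Z is in B at time k exactly when tau > k. *)
have Z_in k w : B (Z k w) <-> forall j, (j <= k)%N -> B (X j w).
  have [Zin _] := stopped_chainP (kaczmarz_step x) B x0 (fun j => a j w) k.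
  split=> [/Zin Xin j /Xin|Xin]; first by rewrite /X kaczmarz_driven.
  by apply/Zin => j /Xin; rewrite /X kaczmarz_driven.
have ZX k w : B (Z k w) -> Z k w = X k w.
  move=> /Z_in Xin.
  have [_ ZE] := stopped_chainP (kaczmarz_step x) B x0 (fun j => a j w) k.
  rewrite /X kaczmarz_driven; apply: ZE => j /Xin.
  by rewrite /X kaczmarz_driven.
have tau_inf w : tau w = +oo%E <-> forall k, B (Z k w).
  split=> [/exit_time_infinite Xin k|Zin]; first by apply/Z_in => j _.
  by apply/exit_time_infinite => k; exact: (proj1 (Z_in k w) (Zin k)).
have tau_fin w : (tau w < +oo)%E <-> exists k, ~ B (Z k w).
  split=> [/exit_time_finite[k nBk]|[k nBk]].
    by exists k => /Z_in /(_ k (leqnn k)).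
  rewrite ltey; apply/eqP => /tau_inf; exact.
split; first exact: alpha_sigma_gt0.
  move=> k; rewrite unlock.
  have mX : measurable_fun setT (X k : T -> borel_rV R n).
    have -> : X k =
        fun w => driven_chain (kaczmarz_step x) x0 (fun j => a j w) k.
      by apply/funext => w; rewrite /X kaczmarz_driven.
    have mstep : measurable_fun setT (fun z : borel_rV R n * borel_rV R n =>
        kaczmarz_step x z.2 z.1 : borel_rV R n).
      apply: measurable_kaczmarz_step; first exact: measurable_snd.
      exact: measurable_fst.
    exact: (@measurable_driven_chain _ _ _ P _ (borel_rV R n) _ (borel_rV R n)
      (kaczmarz_step x) x0 a mstep k).
  have mtau : measurable [set w' | tau w' = +oo%E].
    have -> : [set w' | tau w' = +oo%E] = \bigcap_k [set w | B (Z k w)].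
      apply/seteqP; split=> [w /= /tau_inf Zin j _|w Zin]; first exact: Zin.
      by apply/tau_inf => j; exact: Zin.
    exact: bigcapT_measurable.
  (* The iteration contracts at the better rate 1 - 1 / (5 n). *)
  apply: (@le_trans _ _ ((1 - (5 * n%:R)^-1) ^+ k * dot (x0 - x) (x0 - x))%:E).
    apply: le_trans (inside_sqdist_decay x x0 d T P a x_neq0 a_indep a_unif k).
    apply: ge0_le_integral => //.
    - by move=> w _; rewrite lee_fin mulr_ge0 ?sqr_ge0.
    - apply/measurable_EFinP; apply: measurable_funM.
        by under eq_fun do rewrite norm2_sqr; exact: measurable_sqdist.
      exact: measurable_indic.
    - by apply: measurable_sqdist_inside => //; exact: measurable_stopped.
    move=> w _; rewrite lee_fin indicE norm2_sqr.
    case: (boolP (w \in _)) => [|_]; last first.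
      by rewrite mulr0 sqdist_inside_ge0.
    rewrite inE /= mulr1 => /tau_inf /(_ k) BZ.
    by rewrite /sqdist_inside asboolT// /sqdist -ZX.
  rewrite lee_fin norm2_sqr ler_wpM2r ?dot_ge0//.
  have n1 : 0 < n%:R :> R by rewrite ltr0n.
  have rate : 1 - (5 * n%:R)^-1 <= 1 - alpha_sigma R / n%:R.
    by rewrite lerD2l lerN2 invfM ler_wpM2r ?invr_ge0 ?alpha_sigma_le// ltW.
  have rate0 := contraction_rate_ge0 R n n0.
  apply: lerXn2r (rate); rewrite nnegrE //; exact: le_trans rate.
(* The events tau <= k increase to tau < oo. *)
have -> : [set w | (tau w < +oo)%E] = \bigcup_k [set w | ~ B (Z k w)].
  apply/seteqP; split=> [w /= /tau_fin[k nB]|w [k _ nB]]; first by exists k.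
  by apply/tau_fin; exists k.
have mout k : measurable [set w | ~ B (Z k w)] by exact: (measurableC (mZ k)).
have mono : {homo (fun k => [set w | ~ B (Z k w)]) :
    i j / (i <= j)%N >-> (i <= j)%O}.
  move=> i j ij; apply/subsetPset => w /= nBi Bj; apply: nBi.
  by apply/Z_in => m mi; move/Z_in: Bj; apply; exact: leq_trans mi ij.
apply: cvge_le
  (nondecreasing_cvg_mu (mu := P) mout (bigcupT_measurable _ mout) mono).
by apply: nearW => k; exact: exit_probability_le.
Qed.
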